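(* Let $A$ be a real $m\times n$ matrix with nonzero rows $a_1,\dots,a_m$, let $Ax=b$ be a consistent linear system with solution $x\in\mathbb{R}^n$, and let $\sigma>0$. Let $\tilde b=b+\varepsilon$, where $\varepsilon=(\varepsilon_1,\dots,\varepsilon_m)$ has independent random entries such that $\varepsilon_i$ has mean $0$ and variance $\sigma^2\|a_i\|^2$. Let $x_0\in\mathbb{R}^n$ be a fixed vector with $x_0\neq x$. Let the row indices $i_0,i_1,\dots$ be chosen at random, independently of $\varepsilon$, without replacement: given $i_0,\dots,i_{k-1}$, the index $i_k$ is chosen from $\{1,\dots,m\}\setminus\{i_0,\dots,i_{k-1}\}$ with probability proportional to $\|a_{i_k}\|^2$. Let $A_k$ be the $(m-k)\times n$ matrix formed by deleting the rows $i_0,\dots,i_{k-1}$ from $A$. Let $\eta>0$ and $N\le m$ be such that $$\kappa(A_k)^{-2}\ge \eta\quad\text{for all } k\le N-1 .$$ Set $\beta_0:=\|x-x_0\|^2/\sigma^2$ and define recursively $$\alpha_k=\frac{\eta\beta_k}{\eta\beta_k+1},\qquad \beta_{k+1}=\beta_k(1-\eta\alpha_k),\qquad k=0,1,\dots.$$ Let $x_k$ be defined by $$x_{k+1}=x_k+\alpha_k\,\frac{\tilde b_{i_k}-\langle a_{i_k},x_k\rangle}{\|a_{i_k}\|^2}\,a_{i_k}.$$ Then $$\mathbb{E}\|x_k-x\|^2\le \sigma^2\beta_k\le f(k)\quad\text{for all } k\le N,$$ where $$f(k):=\frac{\sigma^2}{\eta\, W(c\,e^{\eta k})},\qquad c: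=\frac{\sigma^2}{\eta\|x-x_0\|^2}\exp\left(\frac{\sigma^2}{\eta\|x-x_0\|^2}\right).$$
   Context: $\|\cdot\|$ and $\langle\cdot,\cdot\rangle$ are the $\ell^2$ norm and inner product. For a matrix $B$ having a left inverse (full column rank), $\kappa(B):=\|B\|_F\,\|B^{-1}\|$, where $B^{-1}$ is the left inverse of $B$ (the Moore–Penrose pseudoinverse), $\|B^{-1}\|$ is its operator norm and $\|B\|_F$ is the Frobenius norm of $B$; thus $\kappa(B)^{-2}=\sigma_{\min}(B)^2/\|B\|_F^2$, where $\sigma_{\min}(B)$ is the smallest singular value. The condition $\kappa(A_k)^{-2}\ge\eta$ (which includes that $A_k$ has full column rank) is assumed for every realization of the random indices. $W$ denotes the Lambert-$W$ function, the inverse of $t\mapsto te^t$ on $[0,\infty)$. The expectation is over both the noise and the random row choices. *)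

(* Defs.v *)
From HB Require Import structures.
From mathcomp Require Import all_boot all_order all_algebra.
From mathcomp Require Import all_classical all_reals all_analysis.

Set Implicit Arguments.
Unset Strict Implicit.
Unset Printing Implicit Defensive.

Import Order.TTheory GRing.Theory Num.Theory.
Import numFieldNormedType.Exports.

Local Open Scope classical_set_scope.
Local Open Scope ring_scope.

Section linear_algebra.
Context {R : realType}.

Definition inner (n : nat) (u v : 'cV[R]_n) : R := \sum_(i < n) u i 0 * v i 0.

(* The norm `|u| that MathComp-Analysis puts on matrices is the max norm. *)
Definition l2norm (n : nat) (u : 'cV[R]_n) : R := Num.sqrt (inner u u).

Definition frobenius_norm (m n : nat) (B : 'M[R]_(m, n)) : R :=
  Num.sqrt (\sum_(i < m) \sum_(j < n) B i j ^+ 2).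

Definition operator_norm (m n : nat) (B : 'M[R]_(m, n)) : R :=
  sup [set l2norm (B *m v) | v in [set v : 'cV[R]_n | l2norm v <= 1]].

(* The four Penrose equations. *)
Definition is_moore_penrose (m n : nat) (B : 'M[R]_(m, n)) (C : 'M[R]_(n, m)) :
    Prop :=
  [/\ B *m C *m B = B, C *m B *m C = C,
      (B *m C)^T = B *m C & (C *m B)^T = C *m B].

(* MathComp's pinvmx is some partial inverse, in general not the
   Moore-Penrose one. *)
Definition moore_penrose (m n : nat) (B : 'M[R]_(m, n)) : 'M[R]_(n, m) :=
  xget 0 [set C | is_moore_penrose B C].

(* Only meant for B of full column rank, that is, row_full B. *)
Definition kappa (m n : nat) (B : 'M[R]_(m, n)) : R :=
  frobenius_norm B * operator_norm (moore_penrose B).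

Definition row_vec (m n : nat) (A : 'M[R]_(m, n)) (i : 'I_m) : 'cV[R]_n :=
  (row i A)^T.

Definition delete_rows (m n : nat) (S : {set 'I_m}) (A : 'M[R]_(m, n)) :
    'M[R]_(#|~: S|, n) :=
  rowsub (@enum_val _ (mem (~: S))) A.

Definition kaczmarz_step (m n : nat) (A : 'M[R]_(m, n)) (b : 'cV[R]_m)
    (alpha : R) (i : 'I_m) (y : 'cV[R]_n) : 'cV[R]_n :=
  let a := row_vec A i in
  y + (alpha * ((b i 0 - inner a y) / l2norm a ^+ 2)) *: a.

(* There are only m indices i_0, ..., i_(m-1), hence m steps; for k > m the
   sequence is constant, which is a dummy value. *)
Fixpoint kaczmarz (m n : nat) (A : 'M[R]_(m, n)) (b : 'cV[R]_m)
    (alpha : nat -> R) (x0 : 'cV[R]_n) (i : 'I_m -> 'I_m) (k : nat) :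
    'cV[R]_n :=
  if k is k'.+1 then
    let y := kaczmarz A b alpha x0 i k' in
    if insub k' is Some l then kaczmarz_step A b (alpha k') (i l) y else y
  else x0.

End linear_algebra.

Section parameters.
Context {R : realType}.

Definition relaxation (eta beta : R) : R := eta * beta / (eta * beta + 1).

Fixpoint beta_seq (eta beta0 : R) (k : nat) : R :=
  if k is k'.+1 then
    let beta := beta_seq eta beta0 k' in beta * (1 - eta * relaxation eta beta)
  else beta0.

Definition alpha_seq (eta beta0 : R) (k : nat) : R :=
  relaxation eta (beta_seq eta beta0 k).

Definition lambertW : R -> R :=
  'pinv_(fun=> 0) [set t : R | 0 <= t] (fun t => t * expR t).

End parameters.

Section random.
Context d (T : measurableType d) (R : realType) (P : probability T R).

Definition mutually_independent (m : nat) (X : 'I_m -> {RV P >-> R}) : Prop :=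
  forall (J : {set 'I_m}) (B : 'I_m -> set R), (forall i, measurable (B i)) ->
  P (\bigcap_(i in [set` J]) (X i @^-1` B i)) =
  (\prod_(i in J) P (X i @^-1` B i))%E.

(* 'I_m is not a measurableType, as it is empty for m = 0; random indices are
   therefore plain functions, measurable for the discrete sigma-algebra. *)
Definition sigma_indices (m : nat) (i : 'I_m -> T -> 'I_m) : set (set T) :=
  <<s \bigcup_k preimage_set_system setT (i k) discrete_measurable >>.

Definition sigma_noise (m : nat) (X : 'I_m -> {RV P >-> R}) : set (set T) :=
  g_sigma_preimage (fun j => X j : T -> R).

Definition independent_of_noise (m : nat) (i : 'I_m -> T -> 'I_m)
    (X : 'I_m -> {RV P >-> R}) : Prop :=
  forall E F : set T, sigma_indices i E -> sigma_noise X F ->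
  P (E `&` F) = (P E * P F)%E.

(* The set {i_0, ..., i_(k-1)} of an index sequence i. *)
Definition first_indices (m : nat) (i : 'I_m -> 'I_m) (k : nat) : {set 'I_m} :=
  [set i l | l : 'I_m & (l < k)%N]%SET.

(* The conditional probability that i_k = s k given i_0 = s 0, ...,
   i_(k-1) = s (k-1) is w (s k) divided by the sum of the weights of the
   indices not yet chosen, or 0 if s k has already been chosen; this is stated
   multiplied by the probability of the conditioning event. *)
Definition sampled_without_replacement (m : nat) (w : 'I_m -> R)
    (i : 'I_m -> T -> 'I_m) : Prop :=
  [/\ forall k j, measurable (i k @^-1` [set j]),
      forall t : T, injective (fun k => i k t) &
  forall (s : 'I_m -> 'I_m) (k : 'I_m),
    P [set t | forall l : 'I_m, (l <= k)%N -> i l t = s l] =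
    (P [set t | forall l : 'I_m, (l < k)%N -> i l t = s l] *
     (if s k \in first_indices s k then 0
      else w (s k) / \sum_(j in ~: first_indices s k) w j)%:E)%E].

End random.

(* Main.v *)
(* For a fixed index sequence the error x_k - x is an affine function of the
   noise in which the entries not yet sampled do not occur. Since the noise
   entries are pairwise uncorrelated and independent of the indices, conditioning
   on the index sequence gives
     E|x_(k+1) - x|^2 = E|x_k - x|^2 - (2 alpha_k - alpha_k^2) E[res_k]
                        + alpha_k^2 sigma^2,
   where res_k = <a_(i_k), x_k - x>^2 / |a_(i_k)|^2. Averaging res_k over i_k
   given the past yields |A_k (x_k - x)|^2 / |A_k|_F^2, which is at least
   eta |x_k - x|^2 by the condition number bound; alpha_k is the minimizer of
   the resulting bound, and its minimum is sigma^2 beta_(k+1).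
   As for f, w_k = 1 / (eta beta_k) satisfies
   w_(k+1) exp(w_(k+1)) >= exp(eta) w_k exp(w_k), hence w_k >= W(c exp(eta k)). *)
From HB Require Import structures.
Require Import Defs.
From mathcomp Require Import all_boot all_order all_algebra.
From mathcomp Require Import all_classical all_reals all_analysis.
From mathcomp Require Import measurable_realfun ring lra.

Set Implicit Arguments.
Unset Strict Implicit.
Unset Printing Implicit Defensive.

Import Order.TTheory GRing.Theory Num.Theory.
Import numFieldNormedType.Exports.

Local Open Scope ring_scope.

(** * Euclidean geometry and the condition number bound *)

Section euclidean_space.
Context {R : realType}.

Lemma innerC n (u v : 'cV[R]_n) : inner u v = inner v u.
Proof. by apply: eq_bigr => i _; rewrite mulrC. Qed.

Lemma innerDl n (u v w : 'cV[R]_n) : inner (u + v) w = inner u w + inner v w.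
Proof. by rewrite -big_split; apply: eq_bigr => i _; rewrite mxE mulrDl. Qed.

Lemma innerZl n a (u v : 'cV[R]_n) : inner (a *: u) v = a * inner u v.
Proof. by rewrite mulr_sumr; apply: eq_bigr => i _; rewrite mxE mulrA. Qed.

Lemma innerDr n (u v w : 'cV[R]_n) : inner w (u + v) = inner w u + inner w v.
Proof. by rewrite innerC innerDl !(innerC w). Qed.

Lemma innerZr n a (u v : 'cV[R]_n) : inner v (a *: u) = a * inner v u.
Proof. by rewrite innerC innerZl (innerC v). Qed.

Lemma inner0r n (u : 'cV[R]_n) : inner u 0 = 0.
Proof. by rewrite -(scale0r 0) innerZr mul0r. Qed.

Lemma inner_sumr n (I : finType) (F : I -> 'cV[R]_n) (u : 'cV[R]_n) :
  inner u (\sum_i F i) = \sum_i inner u (F i).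
Proof.
by apply: (big_morph _ (fun v w => innerDr v w u)); exact: inner0r.
Qed.

Lemma inner_ge0 n (u : 'cV[R]_n) : 0 <= inner u u.
Proof. by apply: sumr_ge0 => i _; rewrite -expr2 sqr_ge0. Qed.

Lemma inner_eq0 n (u : 'cV[R]_n) : (inner u u == 0) = (u == 0).
Proof.
apply/idP/eqP => [|->]; last by rewrite inner0r.
rewrite psumr_eq0 => [/allP u0|i _]; last by rewrite -expr2 sqr_ge0.
apply/colP => i; have := u0 i (mem_index_enum _).
by rewrite -expr2 sqrf_eq0 mxE => /eqP.
Qed.

Lemma inner_gt0 n (u : 'cV[R]_n) : u != 0 -> 0 < inner u u.
Proof. by move=> u0; rewrite lt_def inner_eq0 u0 inner_ge0. Qed.

Lemma sqr_l2norm n (u : 'cV[R]_n) : l2norm u ^+ 2 = inner u u.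
Proof. by rewrite sqr_sqrtr // inner_ge0. Qed.

Lemma l2norm_ge0 n (u : 'cV[R]_n) : 0 <= l2norm u.
Proof. exact: sqrtr_ge0. Qed.

Lemma l2normZ n a (u : 'cV[R]_n) : l2norm (a *: u) = `|a| * l2norm u.
Proof.
by rewrite /l2norm innerZl innerZr mulrA -expr2 sqrtrM ?sqr_ge0// sqrtr_sqr.
Qed.

Lemma l2norm_gt0 n (u : 'cV[R]_n) : u != 0 -> 0 < l2norm u.
Proof. by move=> u0; rewrite sqrtr_gt0 inner_gt0. Qed.

Lemma cauchy_schwarz n (u v : 'cV[R]_n) :
  inner u v ^+ 2 <= inner u u * inner v v.
Proof.
have [->|/inner_gt0 v0] := eqVneq v 0; first by rewrite !inner0r mulr0 expr0n.
(* The squared norm of this vector is <v,v> times the gap in the inequality. *)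
have := inner_ge0 (inner v v *: u + (- inner u v) *: v).
rewrite !(innerDl, innerDr, innerZl, innerZr) (innerC v u) => h.
rewrite -subr_ge0 -(pmulr_rge0 _ v0); move: h; congr (is_true (0 <= _)).
by ring.
Qed.

Lemma mulmx_row_inner m n (B : 'M[R]_(m, n)) (v : 'cV[R]_n) l :
  (B *m v) l 0 = inner (row_vec B l) v.
Proof. by rewrite mxE; apply: eq_bigr => j _; rewrite !mxE. Qed.

Lemma inner_mulmx m n (B : 'M[R]_(m, n)) (v : 'cV[R]_n) :
  inner (B *m v) (B *m v) = \sum_l inner (row_vec B l) v ^+ 2.
Proof. by apply: eq_bigr => l _; rewrite mulmx_row_inner expr2. Qed.

Lemma sqr_frobenius_norm m n (B : 'M[R]_(m, n)) :
  frobenius_norm B ^+ 2 = \sum_l inner (row_vec B l) (row_vec B l).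
Proof.
rewrite sqr_sqrtr; last first.
  by apply: sumr_ge0 => l _; apply: sumr_ge0 => j _; rewrite sqr_ge0.
by apply: eq_bigr => l _; apply: eq_bigr => j _; rewrite !mxE expr2.
Qed.

Lemma l2norm_mulmx_le_frobenius m n (B : 'M[R]_(m, n)) (v : 'cV[R]_n) :
  l2norm (B *m v) <= frobenius_norm B * l2norm v.
Proof.
rewrite -(@ler_pXn2r _ 2) ?nnegrE ?mulr_ge0 ?sqrtr_ge0//.
rewrite exprMn !sqr_l2norm sqr_frobenius_norm inner_mulmx mulr_suml.
by apply: ler_sum => l _; exact: cauchy_schwarz.
Qed.

Lemma l2norm_mulmx_le m n (B : 'M[R]_(m, n)) (v : 'cV[R]_n) :
  l2norm (B *m v) <= operator_norm B * l2norm v.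
Proof.
have [->|v0] := eqVneq v 0.
  by rewrite mulmx0 /l2norm !inner0r sqrtr0 mulr0.
have vn0 := l2norm_gt0 v0.
rewrite -ler_pdivrMr//.
(* The supremum is an upper bound only because the set is bounded, here by the Frobenius norm. *)
apply: ub_le_sup.
  exists (frobenius_norm B) => _ [w /= w1 <-].
  apply: le_trans (l2norm_mulmx_le_frobenius B w) _.
  by rewrite ler_piMr ?sqrtr_ge0.
exists ((l2norm v)^-1 *: v).
  by rewrite /= l2normZ ger0_norm ?invr_ge0 ?l2norm_ge0// mulVf ?gt_eqF.
by rewrite -scalemxAr l2normZ ger0_norm ?invr_ge0 ?l2norm_ge0// mulrC.
Qed.

(* If xget fell back on its default value 0 in the choice of the pseudoinverse,
   kappa B would vanish, contradicting 0 < eta <= 0^-1 = 0. *)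
Lemma le_inv_sqr_kappa m n (B : 'M[R]_(m, n)) (eta : R) (e : 'cV[R]_n) :
  row_full B -> 0 < eta -> eta <= kappa B ^- 2 ->
  eta * frobenius_norm B ^+ 2 * inner e e <= inner (B *m e) (B *m e).
Proof.
move=> Bfull eta0 etaB; set C := moore_penrose B.
have k0 : kappa B != 0.
  by apply: contraTneq etaB => ->; rewrite expr0n invr0 -ltNge.
have MP : is_moore_penrose B C.
  have [MPB|noMP] := pselect (exists C', is_moore_penrose B C').
    exact: (xgetPex 0 MPB).
  move: k0; rewrite /kappa (_ : moore_penrose B = 0); last first.
    by apply: xgetPN => C' MPC'; apply: noMP; exists C'.
  have -> : operator_norm (0 : 'M[R]_(n, m)) = 0; last by rewrite mulr0 eqxx.
  apply/eqP; rewrite eq_le; apply/andP; split.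
    apply: ge_sup.
      by exists 0, 0; rewrite /= ?mulmx0 /l2norm inner0r sqrtr0.
    by move=> _ [w _ <-]; rewrite mul0mx /l2norm inner0r sqrtr0.
  apply: ub_le_sup; last by exists 0; rewrite /= ?mulmx0 /l2norm inner0r sqrtr0.
  by exists 0 => _ [w _ <-]; rewrite mul0mx /l2norm inner0r sqrtr0.
(* Full column rank gives a left inverse [D], which cancels the leading [B] in B C B = B. *)
have CB : C *m B = 1%:M.
  have [D DB] := row_fullP Bfull.
  by case: MP => BCB _ _ _; rewrite -[LHS]mul1mx -DB -!mulmxA (mulmxA B) BCB.
have eE : e = C *m (B *m e) by rewrite mulmxA CB mul1mx.
have h : inner e e <= operator_norm C ^+ 2 * inner (B *m e) (B *m e).
  rewrite -!sqr_l2norm -exprMn ler_pXn2r ?nnegrE ?l2norm_ge0//.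
    by rewrite {1}eE l2norm_mulmx_le.
  by apply: le_trans (l2norm_mulmx_le C (B *m e)); rewrite l2norm_ge0.
have k2 : 0 < kappa B ^+ 2 by rewrite lt_def sqrf_eq0 k0 sqr_ge0.
have : eta * kappa B ^+ 2 <= 1 by rewrite -ler_pdivlMr// mul1r.
have F0 := sqr_ge0 (frobenius_norm B).
have := inner_ge0 (B *m e).
rewrite /kappa exprMn -/C => ge0 le1.
apply: le_trans (_ : eta * frobenius_norm B ^+ 2 *
   (operator_norm C ^+ 2 * inner (B *m e) (B *m e)) <= _).
  by rewrite ler_wpM2l// mulr_ge0// ltW.
by rewrite mulrA -[leRHS]mul1r ler_wpM2r// -mulrA.
Qed.

(** Reindexing the rows of the submatrix by the complement of [S] turns its squared Frobenius norm
    into the total sampling weight of the indices still available. *)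
Lemma delete_rows_lower_bound m n (A : 'M[R]_(m, n)) (S : {set 'I_m})
    (eta : R) (e : 'cV[R]_n) :
  let B := delete_rows S A in
  row_full B -> 0 < eta -> eta <= kappa B ^- 2 ->
  eta * (\sum_(l in ~: S) inner (row_vec A l) (row_vec A l)) * inner e e
    <= \sum_(l in ~: S) inner (row_vec A l) e ^+ 2.
Proof.
move=> B Bfull eta0 etaB.
have := le_inv_sqr_kappa e Bfull eta0 etaB.
have rowB l : row_vec B l = row_vec A (enum_val l).
  by apply/colP => j; rewrite !mxE.
rewrite sqr_frobenius_norm inner_mulmx ![\sum_(l in ~: S) _]big_enum_val /=.
by under eq_bigr do rewrite rowB; under [leRHS]eq_bigr do rewrite rowB.
Qed.

End euclidean_space.

(** * The Lambert function on the nonnegative half-line *)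

Section lambert_function.
Context {R : realType}.
Implicit Types t y w : R.

Lemma mulr_expR_lt t w : 0 <= t -> t < w -> t * expR t < w * expR w.
Proof.
by move=> t0 tw; rewrite ltr_pM ?expR_ge0 ?ltr_expR.
Qed.

(** Both claims follow once t e^t is known to map the nonnegative half-line onto itself, since
    [lambertW] is a right inverse on the image. *)
Lemma lambertW_ge0_mulr_expR y : 0 <= y ->
  0 <= lambertW y /\ lambertW y * expR (lambertW y) = y.
Proof.
move=> y0.
pose f : R -> R := fun t => t * expR t.
have surjf : set_surj [set t : R | 0 <= t] [set t : R | 0 <= t] f.
  move=> z /= z0.
  have cf : {within `[0, z], continuous f}%classic.
    apply: continuous_subspaceT => t.
    by apply: cvgM; [exact: cvg_id | exact: continuous_expR].
  (* Since e^z >= 1, the value [z] lies between f(0) = 0 and f(z). *)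
  have fz : z <= f z by rewrite ler_peMr// -expR0 ler_expR.
  have [|t] := IVT z0 cf (v := z).
    by rewrite {1 3}/f mul0r ge_min z0 le_max fz orbT.
  by rewrite in_itv/= => /andP[t0 _] <-; exists t.
split; last by apply: (@surjpK _ _ (fun=> 0) _ _ f surjf y); rewrite inE.
by apply: (@surjpinv_image_sub _ _ (fun=> 0) _ _ f surjf); exists y.
Qed.

Lemma lambertW_gt0 y : 0 < y -> 0 < lambertW y.
Proof.
move=> y0; have [W0 WE] := lambertW_ge0_mulr_expR (ltW y0).
rewrite lt_def W0 andbT; apply: contraTneq y0 => W00.
by rewrite -WE W00 mul0r ltxx.
Qed.

Lemma lambertW_le y w : 0 <= y -> 0 <= w -> y <= w * expR w -> lambertW y <= w.
Proof.
move=> y0 w0 yw; have [W0 WE] := lambertW_ge0_mulr_expR y0.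
by rewrite leNgt; apply/negP => /(mulr_expR_lt w0); rewrite WE ltNge yw.
Qed.

End lambert_function.

(** * The parameter recursion and its comparison with the Lambert function *)

Section relaxation_parameters.
Context {R : realType}.
Variables (eta beta0 : R).
Hypotheses (eta0 : 0 < eta) (beta00 : 0 < beta0).

Lemma relaxation_itv (beta : R) : 0 < beta -> 0 < relaxation eta beta < 1.
Proof.
move=> b0; have eb : 0 < eta * beta by rewrite mulr_gt0.
by rewrite /relaxation divr_gt0 ?ltr_pdivrMr ?addr_gt0//= mul1r ltrDl.
Qed.

(** Positivity survives a step because eta <= 1 and alpha < 1. The guard on [eta <= 1] allows for N
    = 0, where the condition number bound says nothing and only k = 0 arises. *)
Lemma beta_seq_gt0 k : ((0 < k)%N -> eta <= 1) -> 0 < beta_seq eta beta0 k.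
Proof.
elim: k => //= k IH /(_ isT) eta1; have {}IH := IH (fun=> eta1).
have /andP[a0 a1] := relaxation_itv IH.
rewrite mulr_gt0// subr_gt0 -[ltRHS]mulr1.
apply: le_lt_trans (_ : 1 * relaxation eta (beta_seq eta beta0 k) < _).
  by rewrite ler_wpM2r// ltW.
by rewrite ltr_pM2l.
Qed.

(* With w := (eta * beta)^-1 one has w' = w / (1 - y) for y := eta / (1 + w),
   hence w' - w >= w y and ln (w' / w) >= y, and y (1 + w) = eta. *)
Lemma relaxed_expR_growth (beta : R) (w := (eta * beta)^-1)
    (w' := (eta * (beta * (1 - eta * relaxation eta beta)))^-1) :
  eta <= 1 -> 0 < beta -> expR eta * (w * expR w) <= w' * expR w'.
Proof.
move=> eta1 b0; have eb : 0 < eta * beta by rewrite mulr_gt0.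
have w0 : 0 < w by rewrite invr_gt0.
pose y := eta / (1 + w).
have w10 : 0 < 1 + w by rewrite addr_gt0.
have y0 : 0 < y by rewrite divr_gt0.
have y1 : y < 1.
  by rewrite ltr_pdivrMr// mul1r (le_lt_trans eta1)// ltrDl.
have ebN : eta * beta + 1 != 0 by rewrite gt_eqF// addr_gt0.
have yE : eta * relaxation eta beta = y.
  rewrite /y /relaxation /w; field.
  by apply/and3P; split=> //; rewrite gt_eqF.
have w'E : w' * (1 - y) = w.
  rewrite /w' yE /w; field.
  by apply/and3P; split; rewrite gt_eqF ?subr_gt0.
have yw : y * (1 + w) = eta by rewrite /y divfK// gt_eqF.
have w'0 : 0 < w' by rewrite -(pmulr_lgt0 _ (_ : 0 < 1 - y)) ?w'E ?subr_gt0.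
have expy : 1 - y <= expR (- y) by exact: expR_ge1Dx.
have ww' : w + w * y <= w' by nra.
have -> : expR eta * (w * expR w) = w' * (1 - y) * (expR y * expR (w + w * y)).
  by rewrite w'E -expRD mulrCA -expRD; congr (_ * expR _); rewrite -yw; ring.
rewrite -mulrA ler_pM2l// mulrA.
apply: le_trans (_ : 1 * expR (w + w * y) <= _); last first.
  by rewrite mul1r ler_expR.
rewrite ler_wpM2r ?expR_ge0//.
apply: le_trans (_ : expR (- y) * expR y <= _).
  by rewrite ler_wpM2r ?expR_ge0.
by rewrite -expRD addNr expR0.
Qed.

Lemma beta_seq_expR_growth k (w0 := (eta * beta0)^-1)
    (w := (eta * beta_seq eta beta0 k)^-1) :
  ((0 < k)%N -> eta <= 1) ->
  w0 * expR w0 * expR (eta * k%:R) <= w * expR w.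
Proof.
rewrite {}/w; elim: k => [|k IH] /=; first by rewrite mulr0 expR0 mulr1.
move=> /(_ isT) eta1.
apply: le_trans (relaxed_expR_growth eta1 (beta_seq_gt0 (fun=> eta1))).
by rewrite -natr1 mulrDr mulr1 expRD mulrA mulrC ler_wpM2l ?expR_ge0// IH.
Qed.

Lemma beta_seq_le_lambertW k (c := (eta * beta0)^-1) :
  ((0 < k)%N -> eta <= 1) ->
  beta_seq eta beta0 k <=
  (eta * lambertW (c * expR c * expR (eta * k%:R)))^-1.
Proof.
move=> eta1; have c0 : 0 < c by rewrite invr_gt0 mulr_gt0.
have y0 : 0 < c * expR c * expR (eta * k%:R) by rewrite !mulr_gt0 ?expR_gt0.
have b0 := beta_seq_gt0 eta1.
have w0 : 0 < (eta * beta_seq eta beta0 k)^-1 by rewrite invr_gt0 mulr_gt0.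
have Wle := lambertW_le (ltW y0) (ltW w0) (beta_seq_expR_growth eta1).
rewrite -[leLHS]invrK lef_pV2 ?posrE ?invr_gt0 ?mulr_gt0 ?lambertW_gt0//.
by rewrite mulrC -ler_pdivlMr// (le_trans Wle)// invfM mulrC.
Qed.

End relaxation_parameters.

(** * Independence and expectations of products *)

Section independence.
Context d (T : measurableType d) (R : realType) (P : probability T R).
Local Open Scope classical_set_scope.

Section product_expectation.
Variables X Y : {RV P >-> R}.
Hypothesis indepXY : forall B C : set R, measurable B -> measurable C ->
  P (X @^-1` B `&` Y @^-1` C) = (P (X @^-1` B) * P (Y @^-1` C))%E.

Let XY (t : T) := (X t, Y t).

Let measurable_XY : measurable_fun setT XY.
Proof. by apply: measurable_fun_pair. Qed.

HB.instance Definition _ := @isMeasurableFun.Build _ _ _ _ XY measurable_XY.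

(** A product measure is determined by its values on rectangles, where independence makes the joint
    law agree with it. *)
Let prodE (D : set (R * R)) : measurable D ->
  (distribution P X \x distribution P Y)%E D =
  distribution P (XY : {RV P >-> (R * R)%type}) D.
Proof.
apply: product_measure_unique => B C mB mC.
exact: indepXY.
Qed.

(** The expectation is an integral against the joint law, which is the product of the marginal laws;
    Fubini then integrates out one variable at a time. *)
Lemma independent_expectationM :
  (X : T -> R) \in Lfun P 1 -> (Y : T -> R) \in Lfun P 1 ->
  (X \* Y) \in Lfun P 1 ->
  ('E_P[X \* Y] = 'E_P[X] * 'E_P[Y])%E.
Proof.
move=> X1 Y1 /Lfun1_integrable XY1.
pose f (z : R * R) := (z.1 * z.2)%:E.
have mf : measurable_fun [set: (R * R)%type] f.
  by apply/measurable_EFinP; apply: measurable_funM.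
rewrite unlock.
transitivity (\int[distribution P (XY : {RV P >-> (R * R)%type})]_z f z)%E.
  by rewrite integral_distribution.
transitivity (\int[(distribution P X \x distribution P Y)%E]_z f z)%E.
  by apply/esym/eq_measure_integral => D mD _; exact: prodE.
have intf : (distribution P X \x distribution P Y)%E.-integrable setT f.
  apply/integrableP; split => //.
  rewrite (eq_measure_integral (distribution P (XY : {RV P >-> (R * R)%type})));
    last by move=> D mD _; exact: prodE.
  rewrite ge0_integral_distribution//; last exact: measurableT_comp.
  by case/integrableP : XY1.
rewrite -integral12_prod_meas1//.
transitivity (\int[distribution P X]_x ('E_P[Y] * x%:E))%E.
  apply: eq_integral => x _; rewrite /fubini_F /f /=.
  under eq_integral do rewrite EFinM.
  rewrite integralZl//; last first.
    by apply: integrable_pushforward => //; exact/Lfun1_integrable.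
  rewrite integral_distribution//; last exact/Lfun1_integrable.
  by rewrite muleC unlock.
rewrite -{1}(fineK (expectation_fin_num Y1)) integralZl//; last first.
  by apply: integrable_pushforward => //; exact/Lfun1_integrable.
rewrite integral_distribution//; last exact/Lfun1_integrable.
by rewrite fineK ?expectation_fin_num// muleC unlock.
Qed.

End product_expectation.

Lemma expectation_lincomb (I : finType) (c : I -> R) (F : I -> T -> R) :
  (forall i, F i \in Lfun P 1) ->
  ('E_P[fun t => (\sum_i c i * F i t)%R] =
   (\sum_i c i * fine ('E_P[F i]))%:E)%E.
Proof.
move=> F1.
have cF1 i : (c i \o* F i)%R \in Lfun P 1 by exact: Lfun_scale.
have -> : (fun t => (\sum_i c i * F i t)%R) =
          \sum_(G <- [seq (c i \o* F i)%R | i <- enum I]) G.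
  rewrite big_map big_enum; apply/funext => t; rewrite fct_sumE.
  by apply: eq_bigr => i _; rewrite mulrC.
rewrite expectation_sum => [|G /mapP[i _ ->//]].
rewrite big_map big_enum -sumEFin; apply: eq_bigr => i _.
by rewrite expectationZl// EFinM fineK// expectation_fin_num.
Qed.

(** * Second moments of the noise, alone and on index events *)

Section noise_moments.
Variables (m : nat) (eps : 'I_m -> {RV P >-> R}) (v : 'I_m -> R).
Hypothesis eps_indep : mutually_independent eps.
Hypothesis eps_mean : forall j, ('E_P[eps j] = 0)%E.
Hypothesis eps_var : forall j, ('V_P[eps j] = (v j)%:E)%E.

(* The constant 1 is treated as one more noise coordinate, None: the error is
   then a linear, not just affine, function of pairwise orthogonal variables. *)
Definition noise_coord (o : option 'I_m) (t : T) : R :=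
  if o is Some j then eps j t else 1.

Definition noise_weight (o : option 'I_m) : R :=
  if o is Some j then v j else 1.

Let eps2E j : ('E_P[eps j \* eps j] = (v j)%:E)%E.
Proof.
rewrite -eps_var /variance covariance.unlock eps_mean /=; congr expectation.
by apply/funext => t; rewrite !fctE /= !subr0.
Qed.

Let Lfun1_le (f g : T -> R) : measurable_fun setT f -> g \in Lfun P 1 ->
  (forall t, `|f t| <= g t) -> f \in Lfun P 1.
Proof.
move=> mf /Lfun1_integrable ig fg; apply/Lfun1_integrable.
apply: le_integrable ig => //; first exact/measurable_EFinP.
by move=> t _ /=; rewrite lee_fin (le_trans (fg t))// ler_norm.
Qed.

(** Zero mean and finite variance make the integral of eps_j^2 finite; as the integrand is
    nonnegative, this is integrability. *)
Let eps2_Lfun1 j : (eps j \* eps j) \in Lfun P 1.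
Proof.
apply/Lfun1_integrable/integrableP; split.
  by apply/measurable_EFinP; exact: measurable_funM.
under eq_integral do rewrite gee0_abs ?lee_fin -?expr2 ?sqr_ge0//.
by have := eps2E j; rewrite unlock => ->; exact: ltry.
Qed.

Let measurable_coord o : measurable_fun setT (noise_coord o).
Proof.
by case: o => [j|] /=; [exact: measurable_funPT | exact: measurable_cst].
Qed.

Let sqr_coord_Lfun1 o : (noise_coord o \* noise_coord o) \in Lfun P 1.
Proof.
case: o => [j|]; first exact: eps2_Lfun1.
have -> : noise_coord None \* noise_coord None = cst 1.
  by apply/funext => t /=; rewrite mulr1.
exact: Lfun_cst.
Qed.

(** The inequality |a b| <= a^2 + b^2 reduces products to squares. *)
Lemma noise_coordM_Lfun1 o o' : (noise_coord o \* noise_coord o') \in Lfun P 1.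
Proof.
apply: (@Lfun1_le _
  ((noise_coord o \* noise_coord o) \+ (noise_coord o' \* noise_coord o'))).
- exact: measurable_funM.
- by rewrite rpredD.
move=> t /=; set a := noise_coord o t; set b := noise_coord o' t.
rewrite ler_norml; have := sqr_ge0 (a - b); have := sqr_ge0 (a + b); nra.
Qed.

Let eps_Lfun1 j : (eps j : T -> R) \in Lfun P 1.
Proof.
have -> : (eps j : T -> R) = noise_coord (Some j) \* noise_coord None.
  by apply/funext => t /=; rewrite mulr1.
exact: noise_coordM_Lfun1.
Qed.

Lemma noise_coord_expectationM o o' :
  ('E_P[noise_coord o \* noise_coord o'] =
   (if o == o' then noise_weight o else 0)%:E)%E.
Proof.
have E1 j : ('E_P[noise_coord (Some j) \* noise_coord None] = 0)%E.
  rewrite -[RHS](eps_mean j); congr expectation.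
  by apply/funext => t /=; rewrite mulr1.
case: o o' => [a|] [b|] /=.
- case: eqVneq => [[<-]|ab]; first exact: eps2E.
  rewrite independent_expectationM ?eps_mean ?mule0//; last first.
    exact: (noise_coordM_Lfun1 (Some a) (Some b)).
  move=> B C mB mC.
  (* Pairwise independence is the case of the two-element set, with [B] at [a] and [C] at [b]. *)
  have := @eps_indep [set a; b]%SET (fun j => if j == a then B else C).
  have ba : b != a by apply: contra_neq ab => ->.
  rewrite big_setU1 ?inE 1?eq_sym// big_set1 eqxx (negbTE ba) => <-; last first.
    by move=> j; case: ifP.
  congr (P _); apply/seteqP; split => t /=.
    move=> [Ba Cb] j /=; rewrite !inE => /orP[] /eqP ->; rewrite ?eqxx//.
    by rewrite (negbTE ba).
  move=> h; split.
    by have /= := h a; rewrite !inE !eqxx; apply.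
  by have /= := h b; rewrite !inE !eqxx (negbTE ba) orbT; apply.
- exact: E1.
- apply: eq_trans (E1 b); congr expectation.
  by apply/funext => t /=; rewrite mulrC.
- rewrite -[RHS](expectation_cst P); congr expectation.
  by apply/funext => t /=; rewrite mulr1.
Qed.

Variable i : 'I_m -> T -> 'I_m.
Hypothesis i_eps : independent_of_noise i eps.

(** Independence from the indices is stated for the sigma-algebra of the noise, so measurability is
    needed relative to it and not only relative to that of [T]. *)
Let sigma_noise_coordM o o' (B : set R) : measurable B ->
  sigma_noise eps ((noise_coord o \* noise_coord o') @^-1` B).
Proof.
pose G := \big[setU/set0]_(j < m) preimage_set_system setT
  (eps j : T -> R) measurable.
have mo (o1 : option 'I_m) :
    measurable_fun setT (noise_coord o1 : g_sigma_algebraType G -> R).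
  case: o1 => [j|] /=; last exact: measurable_cst.
  move=> _ C mC; apply: sub_sigma_algebra.
  rewrite /G (bigD1 j)//=; left; by exists C.
move=> mB.
have := measurable_funM (mo o) (mo o') measurableT mB.
by rewrite setTI.
Qed.

(** An event of the indices is independent of the noise, so the expectation factors. The squared
    error will be expanded into terms of this kind. *)
Lemma indic_noise_coordM (E : set T) o o' : measurable E -> sigma_indices i E ->
  (\1_E \* (noise_coord o \* noise_coord o')) \in Lfun P 1 /\
  ('E_P[\1_E \* (noise_coord o \* noise_coord o')%R] =
   P E * (if o == o' then noise_weight o else 0)%:E)%E.
Proof.
move=> mE sE; set W := noise_coord o \* noise_coord o'.
have mW : measurable_fun setT W by exact: measurable_funM.
have W1 : W \in Lfun P 1 by exact: noise_coordM_Lfun1.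
have EW1 : (\1_E \* W) \in Lfun P 1.
  apply: (@Lfun1_le _ (Num.norm \o W)); last 2 first.
  - exact: Lfun_norm.
  - move=> t /=; rewrite normrM indicE normr_nat ler_piMl//.
    by case: (t \in E).
  by apply: measurable_funM => //; exact: measurable_indic.
split => //.
pose mWf : {RV P >-> R} := HB.pack W (@isMeasurableFun.Build _ _ _ _ W mW).
have m1E : measurable_fun setT (\1_E : T -> R) by exact: measurable_indic.
pose m1f : {RV P >-> R} :=
  HB.pack (\1_E : T -> R) (@isMeasurableFun.Build _ _ _ _ (\1_E : T -> R) m1E).
have E1 : (\1_E : T -> R) \in Lfun P 1.
  by apply/Lfun1_integrable; exact: integrable_indic.
rewrite (@independent_expectationM m1f mWf)//.
  by rewrite expectation_indic// noise_coord_expectationM.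
move=> B C mB mC; apply: i_eps; last exact: sigma_noise_coordM.
(* A preimage under the indicator is empty, [E], its complement or the whole space, each an event of
   the indices. *)
rewrite preimage_indic.
case: ifP => _; case: ifP => _ //.
- rewrite -setC0 /sigma_indices; apply: sigma_algebraC.
  exact: sigma_algebra0.
- by rewrite /sigma_indices; apply: sigma_algebraC.
- exact: sigma_algebra0.
Qed.

End noise_moments.
End independence.

(** * Error coefficients for a fixed index sequence *)

Section error_expansion.
Context {R : realType} (m n : nat).
Variables (A : 'M[R]_(m, n)) (alpha : nat -> R) (e0 : 'cV[R]_n).
Implicit Types (s : 'I_m -> 'I_m) (o : option 'I_m).

(* For a fixed index sequence s the error after k steps is an affine function
   of the noise: Some j indexes the coefficient of the j-th noise entry, and
   None the constant term. *)
Fixpoint error_coef s (k : nat) o : 'cV[R]_n :=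
  if k is k'.+1 then
    let c := error_coef s k' o in
    if insub k' is Some l then
      let a := row_vec A (s l) in
      c + (alpha k' * (((o == Some (s l))%:R - inner a c) / l2norm a ^+ 2)) *: a
    else c
  else if o is None then e0 else 0.

Lemma error_coef_prefix s s' k o :
  (forall l : 'I_m, (l < k)%N -> s l = s' l) ->
  error_coef s k o = error_coef s' k o.
Proof.
elim: k => //= k IH ss'.
rewrite IH => [|l lk]; last by rewrite ss' ?ltnS 1?ltnW.
by case: insubP => //= l _ lk; rewrite ss' ?lk.
Qed.

(** The coefficient of the j-th noise entry starts at 0, and a step at another row maps 0 to 0. *)
Lemma error_coef_eq0 s k j :
  j \notin first_indices s k -> error_coef s k (Some j) = 0.
Proof.
elim: k => //= k IH jk.
have kj (l : 'I_m) : (l < k.+1)%N -> j != s l.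
  move=> lk; apply: contraNneq jk => ->.
  by apply/imsetP; exists l; rewrite ?inE.
rewrite IH; last first.
  by apply/imsetP => -[l]; rewrite inE => lk; apply/eqP/kj; rewrite ltnS ltnW.
case: insubP => //= l _ lk.
rewrite (_ : (Some j == Some (s l)) = false); last first.
  apply/negbTE; have := kj l; rewrite lk => /(_ (ltnSn _)).
  by apply: contra_neq => -[].
by rewrite inner0r subrr mul0r mulr0 scale0r addr0.
Qed.

End error_expansion.

(** [delta] is the indicator that the coefficient belongs to the noise entry being sampled. That
    this entry has not yet entered the error is the hypothesis [delta * inner a c = 0], which
    removes the cross term. *)
Lemma inner_step {R : realType} n (a c : 'cV[R]_n) (g delta : R) :
  inner a a != 0 -> delta * inner a c = 0 -> delta ^+ 2 = delta ->
  let c' := c + (g * ((delta - inner a c) / l2norm a ^+ 2)) *: a in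
  inner c' c' = inner c c - (2 * g - g ^+ 2) * (inner a c ^+ 2 / inner a a)
    + delta * (g ^+ 2 / inner a a).
Proof.
rewrite sqr_l2norm => q0 dac dd /=.
rewrite !(innerDl, innerDr, innerZl, innerZr) (innerC c a).
transitivity (inner c c - (2 * g - g ^+ 2) * (inner a c ^+ 2 / inner a a)
    + delta ^+ 2 * (g ^+ 2 / inner a a)
    + (2 * g - 2 * g ^+ 2) / inner a a * (delta * inner a c)).
  by field.
by rewrite dac mulr0 addr0 dd.
Qed.

(** * The squared error averaged over the noise *)

Section weighted_error.
Context {R : realType} (m n : nat).
Variables (A : 'M[R]_(m, n)) (alpha : nat -> R).
Hypothesis A_neq0 : forall j, row_vec A j != 0.

(** By b = A x a step acts linearly on the error and the fresh noise entry together, so each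
    coefficient follows its own recursion. *)
Lemma kaczmarz_error (x x0 : 'cV[R]_n) (b : 'cV[R]_m) (z : 'I_m -> R)
    (s : 'I_m -> 'I_m) k : A *m x = b ->
  kaczmarz A (b + \col_j z j) alpha x0 s k - x =
  \sum_o (if o is Some j then z j else 1) *: error_coef A alpha (x0 - x) s k o.
Proof.
move=> Axb; elim: k => [|k IH] /=.
  rewrite (bigD1 None)//= scale1r big1 ?addr0// => -[j|]//= _.
  by rewrite scaler0.
case: insubP => [l _ lk|_]; last exact: IH.
move: IH; set y := kaczmarz _ _ _ _ _ _; set c := error_coef _ _ _ _ _.
set e := \sum_o _ => ye; rewrite /kaczmarz_step; set a := row_vec A (s l).
rewrite addrAC ye.
(* The noisy residual is z_(s l) - <a, y - x>; the Kronecker term singles out z_(s l). *)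
have -> : (b + \col_j z j) (s l) 0 - inner a y =
    \sum_o (if o is Some j then z j else 1) *
      ((o == Some (s l))%:R - inner a (c o)).
  under eq_bigr do rewrite mulrBr.
  rewrite sumrB (bigD1 (Some (s l)))//= eqxx mulr1 big1 ?addr0; last first.
    by move=> o /negbTE ->; rewrite mulr0.
  under eq_bigr do rewrite -innerZr.
  rewrite -inner_sumr -/e -ye !mxE -Axb mulmx_row_inner.
  rewrite -(scaleN1r x) innerDr innerZr -/a; ring.
rewrite mulr_suml mulr_sumr scaler_suml -big_split /=; apply: eq_bigr => o _.
by rewrite scalerDr scalerA; congr (_ + _ *: _); ring.
Qed.

Variables (sigma : R) (weight : option 'I_m -> R) (e0 : 'cV[R]_n).
Hypothesis weightE : forall j,
  weight (Some j) = sigma ^+ 2 * l2norm (row_vec A j) ^+ 2.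

(** When [weight] gives the second moments of the orthogonal noise coordinates, this is the mean of
    |x_k - x|^2 over the noise for the index sequence [s]; [weighted_residual] is likewise the mean
    of <a_j, x_k - x>^2 / |a_j|^2. *)
Definition weighted_error (s : 'I_m -> 'I_m) k : R :=
  \sum_o weight o *
    inner (error_coef A alpha e0 s k o) (error_coef A alpha e0 s k o).

Definition weighted_residual (s : 'I_m -> 'I_m) k j : R :=
  (\sum_o weight o * inner (row_vec A j) (error_coef A alpha e0 s k o) ^+ 2)
    / l2norm (row_vec A j) ^+ 2.

Lemma weighted_residual_prefix s s' k j :
  (forall l : 'I_m, (l < k)%N -> s l = s' l) ->
  weighted_residual s k j = weighted_residual s' k j.
Proof.
move=> ss'; congr (_ / _).
by apply: eq_bigr => o _; rewrite !(error_coef_prefix _ _ _ _ ss').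
Qed.

(** Injectivity makes row [s k] new, so its noise coefficient is still 0 and [inner_step] applies to
    every coefficient. *)
Lemma weighted_error_step s (k : 'I_m) : injective s ->
  weighted_error s k.+1 = weighted_error s k
    - (2 * alpha k - alpha k ^+ 2) * weighted_residual s k (s k)
    + alpha k ^+ 2 * sigma ^+ 2.
Proof.
move=> s_inj; have q0 := inner_gt0 (A_neq0 (s k)).
set a := row_vec A (s k) in q0 *; set g := alpha k.
set c := error_coef A alpha e0 s k.
have csk : c (Some (s k)) = 0.
  apply: error_coef_eq0; apply/imsetP => -[l]; rewrite inE => lk /s_inj kl.
  by rewrite kl ltnn in lk.
have stepE o : inner (error_coef A alpha e0 s k.+1 o)
      (error_coef A alpha e0 s k.+1 o) =
    inner (c o) (c o) - (2 * g - g ^+ 2) * (inner a (c o) ^+ 2 / inner a a)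
    + (o == Some (s k))%:R * (g ^+ 2 / inner a a).
  rewrite /= valK /=; apply: inner_step => //; first by rewrite gt_eqF.
    rewrite -/c; have [->|_] := eqVneq o (Some (s k)); last exact: mul0r.
    by rewrite csk inner0r mulr0.
  by case: (o == _); rewrite ?expr1n ?expr0n.
rewrite /weighted_error /weighted_residual -/c.
under eq_bigr do rewrite stepE 2!mulrDr.
rewrite 2!big_split /=; congr (_ + _ + _).
  rewrite -/a sqr_l2norm mulr_suml mulr_sumr -sumrN.
  by apply: eq_bigr => o _; ring.
(* Only the fresh noise entry contributes, and its weight sigma^2 |a|^2 cancels the denominator
   |a|^2. *)
rewrite (bigD1 (Some (s k)))//= eqxx big1 ?addr0; last first.
  by move=> o /negbTE ->; rewrite mul0r mulr0.
rewrite weightE -/a sqr_l2norm.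
by rewrite mulr1n mul1r; field; rewrite gt_eqF.
Qed.

End weighted_error.

(** * Averaging over the next index *)

Section next_index.
Context {R : realType} (m : nat).
Variables (p : {ffun 'I_m -> 'I_m} -> R) (k : 'I_m).
Variables q h : ('I_m -> 'I_m) -> 'I_m -> R.
Hypothesis next_index : forall s : {ffun 'I_m -> 'I_m},
  \sum_(s' : {ffun 'I_m -> 'I_m} |
      [forall l : 'I_m, (l <= k)%N ==> (s' l == s l)]) p s' =
  (\sum_(s' : {ffun 'I_m -> 'I_m} |
      [forall l : 'I_m, (l < k)%N ==> (s' l == s l)]) p s') * q s (s k).
Hypothesis q_prefix : forall s s' : 'I_m -> 'I_m,
  (forall l : 'I_m, (l < k)%N -> s l = s' l) -> q s = q s'.
Hypothesis h_prefix : forall s s' : 'I_m -> 'I_m,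
  (forall l : 'I_m, (l < k)%N -> s l = s' l) -> h s = h s'.

(** Sequences are grouped by their first k entries. On a group [q] and [h] do not vary, and entry k
    equals j on a share [q s j] of its mass. *)
Lemma average_next_index :
  \sum_s p s * h s (s k) = \sum_s p s * \sum_j q s j * h s j.
Proof.
(* Overwriting the entries from position k on by the dummy value [k] gives each prefix a canonical
   representative. *)
pose trunc (s : {ffun 'I_m -> 'I_m}) :=
  [ffun l : 'I_m => if (l < k)%N then s l else k].
have truncP (s u : {ffun 'I_m -> 'I_m}) : trunc s = trunc u <->
    forall l : 'I_m, (l < k)%N -> s l = u l.
  split=> [/ffunP su l lk|su]; first by have := su l; rewrite !ffunE lk.
  by apply/ffunP => l; rewrite !ffunE; case: ifP => // /su.
rewrite (partition_big trunc predT)//= [RHS](partition_big trunc predT)//=.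
apply: eq_bigr => u' _.
have [u /eqP <-|noneu] := pickP (fun s => trunc s == u'); last first.
  by rewrite !big_pred0.
rewrite (partition_big (fun s : {ffun 'I_m -> 'I_m} => s k) predT)//=.
transitivity (\sum_j (\sum_(s | trunc s == trunc u) p s) * (q u j * h u j)).
  apply: eq_bigr => j _.
  (* [v] has the prefix of [u] and j at position k; [next_index] is applied to it. *)
  pose v := [ffun l => if l == k then j else u l].
  have uv (l : 'I_m) : (l < k)%N -> v l = u l.
    by move=> lk; rewrite ffunE; case: eqP lk => // ->; rewrite ltnn.
  have vk : v k = j by rewrite ffunE eqxx.
  transitivity ((\sum_(s : {ffun 'I_m -> 'I_m} |
      (trunc s == trunc u) && (s k == j)) p s) * h u j).
    rewrite mulr_suml; apply: eq_bigr => s /andP[/eqP/truncP su /eqP ->].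
    by rewrite (h_prefix su).
  rewrite mulrA; congr (_ * _).
  rewrite -(q_prefix uv) -{2}vk.
  transitivity (\sum_(s' : {ffun 'I_m -> 'I_m} |
      [forall l : 'I_m, (l <= k)%N ==> (s' l == v l)]) p s').
    apply: eq_bigl => s; apply/andP/forallP => [[/eqP/truncP su /eqP sk] l|sv].
      apply/implyP; rewrite leq_eqVlt => /orP[/eqP/val_inj ->|lk].
        by rewrite sk vk.
      by rewrite uv// su.
    split; last by have := sv k; rewrite leqnn vk.
    apply/eqP/truncP => l lk; have := sv l; rewrite ltnW//= uv//.
    by move/eqP.
  rewrite next_index; congr (_ * _); apply: eq_bigl => s.
  apply/forallP/eqP => [sv|/truncP su l].
    apply/truncP => l lk; have := sv l; rewrite lk/= uv//.
    by move/eqP.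
  by apply/implyP => lk; rewrite uv// su.
rewrite -mulr_sumr mulr_suml; apply: eq_bigr => s /eqP/truncP su.
by rewrite (q_prefix su) (h_prefix su).
Qed.

End next_index.

(** * Events and probabilities of index sequences *)

Section random_indices.
Context d (T : measurableType d) (R : realType) (P : probability T R).
Variables (m : nat) (i : 'I_m -> T -> 'I_m).
Local Open Scope classical_set_scope.

Definition index_event (s : 'I_m -> 'I_m) : set T :=
  [set t | forall l, i l t = s l].

Definition index_prob (s : 'I_m -> 'I_m) : R := fine (P (index_event s)).

(** The measurable space is arbitrary because this serves both for [T] and for the sigma-algebra
    generated by the indices. *)
Lemma measurable_index_eventP d' (T' : measurableType d')
    (i' : 'I_m -> T' -> 'I_m) (s : 'I_m -> 'I_m) : (forall l, measurable (i' l @^-1` [set s l])) ->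
  measurable [set t | forall l, i' l t = s l].
Proof.
move=> mi.
rewrite (_ : [set _ | _] = \big[setI/setT]_(l < m) (i' l @^-1` [set s l])).
  exact: bigsetI_measurable.
rewrite -bigcap_seq; apply/seteqP; split=> t /= h l.
  by move=> _; exact: h.
by apply: h; exact: mem_index_enum.
Qed.

Hypothesis measurable_index : forall k j, measurable (i k @^-1` [set j]).

Lemma measurable_index_event s : measurable (index_event s).
Proof. exact: measurable_index_eventP. Qed.

Lemma sigma_index_event s : sigma_indices i (index_event s).
Proof.
pose G := \bigcup_k preimage_set_system setT (i k) discrete_measurable.
apply: (@measurable_index_eventP _ (g_sigma_algebraType G)) => l.
apply: sub_sigma_algebra; exists l => //; exists [set s l] => //.
by rewrite setTI.
Qed.

Lemma index_prob_ge0 s : 0 <= index_prob s.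
Proof. by apply: fine_ge0. Qed.

Lemma index_prob_gt0 s : index_prob s != 0 -> exists t, forall l, i l t = s l.
Proof.
apply: contra_neqP => /forallNP noP; rewrite /index_prob.
rewrite (_ : index_event s = set0) ?measure0//.
by apply/seteqP; split => // t /noP.
Qed.

Lemma indic_index_event (s : 'I_m -> 'I_m) t :
  \1_(index_event s) t = [forall l, i l t == s l]%:R :> R.
Proof.
rewrite indicE; congr (nat_of_bool _)%:R; apply/idP/forallP.
  by rewrite inE => h l; apply/eqP; exact: h.
by move=> h; rewrite inE => l; apply/eqP.
Qed.

(** The index events partition the sample space, so only the realized sequence contributes. *)
Lemma sum_indic_index_event (F : {ffun 'I_m -> 'I_m} -> R) t :
  \sum_s F s * \1_(index_event s) t = F [ffun l => i l t].
Proof.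
rewrite (bigD1 [ffun l => i l t])//= big1 ?addr0.
  rewrite indic_index_event (_ : [forall l, _]) ?mulr1//.
  by apply/forallP => l; rewrite ffunE.
move=> s si; rewrite indic_index_event.
case: forallP => [h|]; last by rewrite mulr0.
by case/eqP: si; apply/ffunP => l; rewrite ffunE (eqP (h l)).
Qed.

Lemma measurable_index_pred (Q : pred {ffun 'I_m -> 'I_m}) :
  measurable [set t | Q [ffun l => i l t]].
Proof.
rewrite (_ : [set _ | _] = \big[setU/set0]_(s | Q s) index_event s).
  by apply: bigsetU_measurable => s _; exact: measurable_index_event.
rewrite -bigcup_seq_cond; apply/seteqP; split=> t /=.
  move=> Qt; exists [ffun l => i l t]; first by rewrite /= mem_index_enum.
  by move=> l; rewrite ffunE.
move=> [s /= /andP[_ Qs] st].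
by rewrite (_ : [ffun l => i l t] = s)//; apply/ffunP => l; rewrite ffunE st.
Qed.

(** This is the expectation of [sum_indic_index_event] for the indicator of [Q]. *)
Lemma sum_index_prob (Q : pred {ffun 'I_m -> 'I_m}) :
  fine (P [set t | Q [ffun l => i l t]]) = \sum_(s | Q s) index_prob s.
Proof.
have E1 s : (\1_(index_event s) : T -> R) \in Lfun P 1.
  by apply/Lfun1_integrable/integrable_indic; exact: measurable_index_event.
have := @expectation_lincomb _ T R P _ (fun s => (Q s)%:R)
  (fun s : {ffun 'I_m -> 'I_m} => \1_(index_event s)) E1.
under eq_fun do rewrite (sum_indic_index_event (fun s => (Q s)%:R)).
have -> : (fun t => (Q [ffun l => i l t])%:R : R) =
    \1_[set t | Q [ffun l => i l t]].
  apply/funext => t; rewrite indicE.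
  by congr (nat_of_bool _)%:R; rewrite mem_setE.
rewrite expectation_indic; last exact: measurable_index_pred.
move=> ->; rewrite /= [RHS]big_mkcond; apply: eq_bigr => s _.
rewrite expectation_indic; last exact: measurable_index_event.
by case: (Q s); rewrite ?mul1r ?mul0r.
Qed.

End random_indices.

(** Fewer than m indices precede step k, so some row remains, and it is nonzero. *)
Lemma remaining_weight_gt0 {R : realType} m n (A : 'M[R]_(m, n))
    (s : 'I_m -> 'I_m) (k : 'I_m) : (forall j, row_vec A j != 0) ->
  0 < \sum_(l in ~: first_indices s k) inner (row_vec A l) (row_vec A l).
Proof.
move=> A_neq0; set S := first_indices s k.
have [j jS] : exists j, j \in ~: S.
  apply/existsP; rewrite -[[exists _, _]]negbK negb_exists.
  apply/forallP => noj.
  have ST : (#|[set: 'I_m]| <= #|S|)%N.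
    apply: subset_leq_card; apply/fintype.subsetP => j _.
    by have := noj j; rewrite inE negbK.
  have := leq_trans ST (leq_imset_card _ _).
  rewrite cardsT leqNgt => /negP; apply; apply: proper_card.
  apply/properP; split; first exact/fintype.subsetP.
  by exists k; rewrite ?inE ?ltnn.
rewrite (bigD1 j)//= ltr_wpDr ?inner_gt0//.
by apply: sumr_ge0 => l _; exact: inner_ge0.
Qed.

(** * The recursion for the mean square error *)

Section mean_square_error.
Context d (T : measurableType d) (R : realType) (P : probability T R).
Context (m n : nat) (A : 'M[R]_(m, n)) (alpha : nat -> R).
Variables (x x0 : 'cV[R]_n) (b : 'cV[R]_m) (sigma eta : R).
Variables (eps : 'I_m -> {RV P >-> R}) (i : 'I_m -> T -> 'I_m).
Hypothesis A_neq0 : forall j, row_vec A j != 0.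
Hypothesis Axb : A *m x = b.
Hypothesis eps_indep : mutually_independent eps.
Hypothesis eps_mean : forall j, ('E_P[eps j] = 0)%E.
Hypothesis eps_var : forall j,
  ('V_P[eps j] = (sigma ^+ 2 * l2norm (row_vec A j) ^+ 2)%R%:E)%E.
Hypothesis i_sampled :
  sampled_without_replacement P (fun j => l2norm (row_vec A j) ^+ 2) i.
Hypothesis i_eps : independent_of_noise i eps.

Let weight :=
  noise_weight (fun j => sigma ^+ 2 * l2norm (row_vec A j) ^+ 2).

Let err (s : {ffun 'I_m -> 'I_m}) k :=
  weighted_error A alpha weight (x0 - x) s k.

Let prob (s : {ffun 'I_m -> 'I_m}) := index_prob P i s.

Definition mean_square_error k := \sum_s prob s * err s k.

Let measurable_i k j : measurable (i k @^-1` [set j])%classic.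
Proof. by case: i_sampled. Qed.

(** The squared error expands over index sequences and pairs of noise coordinates; by orthogonality
    only equal pairs keep a nonzero expectation. *)
Lemma expectation_kaczmarz k :
  ('E_P[fun t => (l2norm (kaczmarz A (b + \col_j eps j t) alpha x0
      (fun l => i l t) k - x) ^+ 2)%R] = (mean_square_error k)%:E)%E.
Proof.
pose I := ({ffun 'I_m -> 'I_m} * (option 'I_m * option 'I_m))%type.
pose c (y : I) := inner (error_coef A alpha (x0 - x) y.1 k y.2.1)
                        (error_coef A alpha (x0 - x) y.1 k y.2.2).
pose F (y : I) : T -> R := \1_(index_event i y.1) \*
  (noise_coord eps y.2.1 \* noise_coord eps y.2.2).
have F1E (y : I) := indic_noise_coordM eps_indep eps_mean eps_var i_eps
  y.2.1 y.2.2 (measurable_index_event measurable_i y.1) (sigma_index_event y.1).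
transitivity ('E_P[fun t => (\sum_y c y * F y t)%R])%E.
  congr expectation; apply/funext => t.
  rewrite sqr_l2norm kaczmarz_error//.
  transitivity (\sum_(s : {ffun 'I_m -> 'I_m}) (\sum_o \sum_o'
      inner (error_coef A alpha (x0 - x) s k o)
        (error_coef A alpha (x0 - x) s k o') *
      (noise_coord eps o t * noise_coord eps o' t)) * \1_(index_event i s) t).
    rewrite sum_indic_index_event.
    rewrite inner_sumr [RHS]exchange_big /=; apply: eq_bigr => o' _.
    rewrite innerC inner_sumr; apply: eq_bigr => o _.
    have E o1 : error_coef A alpha (x0 - x) (fun l => i l t) k o1 =
      error_coef A alpha (x0 - x) [ffun l => i l t] k o1.
      by apply: error_coef_prefix => l _; rewrite ffunE.
    by rewrite innerZl innerZr !E innerC /noise_coord; ring.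
  rewrite -(pair_bigA _ (fun s oo => c (s, oo) * F (s, oo) t)) /=.
  apply: eq_bigr => s _.
  rewrite -(pair_bigA _ (fun o o' => c (s, (o, o')) * F (s, (o, o')) t)) /=.
  rewrite mulr_suml; apply: eq_bigr => o _.
  rewrite mulr_suml; apply: eq_bigr => o' _.
  by rewrite /c /F /=; ring.
rewrite expectation_lincomb => [|y]; last by case: (F1E y).
congr (_%:E).
rewrite -(pair_bigA _ (fun s oo => c (s, oo) * fine ('E_P[F (s, oo)])%E)) /=.
apply: eq_bigr => s _; rewrite -(pair_bigA _ (fun o o' =>
  c (s, (o, o')) * fine ('E_P[F (s, (o, o'))])%E)) /=.
rewrite mulr_sumr; apply: eq_bigr => o _.
rewrite (bigD1 o)//= big1 ?addr0 => [|o' o'o].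
  rewrite /F (F1E (s, (o, o))).2 eqxx /= fineM ?fin_num_measure//; last first.
    exact: measurable_index_event.
  by rewrite /c /prob /index_prob /weight /=; ring.
by rewrite /F (F1E (s, (o, o'))).2 /= eq_sym (negbTE o'o) mule0 mulr0.
Qed.

Let next (s : 'I_m -> 'I_m) (k j : 'I_m) : R :=
  if j \in first_indices s k then 0
  else l2norm (row_vec A j) ^+ 2 /
       \sum_(l in ~: first_indices s k) l2norm (row_vec A l) ^+ 2.

Lemma average_residual (k : 'I_m) :
  \sum_s prob s * weighted_residual A alpha weight (x0 - x) s k (s k) =
  \sum_s prob s *
    \sum_j next s k j * weighted_residual A alpha weight (x0 - x) s k j.
Proof.
have next_prefix s s' : (forall l : 'I_m, (l < k)%N -> s l = s' l) ->
    next s k = next s' k.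
  move=> ss'; have -> // : next s k = next s' k.
  rewrite /next (_ : first_indices s k = first_indices s' k)//.
  by apply: eq_in_imset => l; rewrite inE => /ss'.
apply: (@average_next_index R m prob k (fun s => next s k)
  (fun s => weighted_residual A alpha weight (x0 - x) s k)) => //; last first.
  move=> s s' ss'; apply/funext => j; exact: weighted_residual_prefix.
move=> s; have E (Q : pred 'I_m) :
    [set t | [forall l, Q l ==> ([ffun l => i l t] l == s l)]]%classic =
    [set t | forall l : 'I_m, Q l -> i l t = s l]%classic.
  apply/seteqP; split=> t /=.
    by move=> /forallP h l Ql; have := h l; rewrite Ql ffunE => /eqP.
  by move=> h; apply/forallP => l; apply/implyP => Ql; rewrite ffunE h.
(* The sampling rule, given for events, becomes one for sums of [index_prob]. *)
case: i_sampled => _ _ /(_ s k) /(congr1 fine).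
rewrite fineM// -?sum_index_prob// ?E//.
have := measurable_index_pred measurable_i
  (fun s' => [forall l : 'I_m, (l < k)%N ==> (s' l == s l)]).
by rewrite E => ?; rewrite fin_num_measure.
Qed.

Lemma sum_prob : \sum_s prob s = 1.
Proof.
rewrite -(sum_index_prob P measurable_i predT) (_ : [set _ | _]%classic = setT).
  by rewrite probability_setT.
by apply/seteqP; split.
Qed.

(** The lower bound is assumed for every vector because it is applied to each error coefficient
    separately. *)
Lemma mean_square_error_step (k : 'I_m) :
  0 <= alpha k <= 1 ->
  (forall t e, eta * (\sum_(l in ~: first_indices (fun l => i l t) k)
        inner (row_vec A l) (row_vec A l)) * inner e e <=
     \sum_(l in ~: first_indices (fun l => i l t) k)
        inner (row_vec A l) e ^+ 2) ->
  mean_square_error k.+1 <=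
  (1 - eta * (2 * alpha k - alpha k ^+ 2)) * mean_square_error k
   + alpha k ^+ 2 * sigma ^+ 2.
Proof.
move=> /andP[a0 a1] bound.
have weight_ge0 o : 0 <= weight o.
  by case: o => [j|] //=; rewrite mulr_ge0 ?sqr_ge0.
have -> : mean_square_error k.+1 = mean_square_error k -
   (2 * alpha k - alpha k ^+ 2) *
   (\sum_s prob s *
     \sum_j next s k j * weighted_residual A alpha weight (x0 - x) s k j)
   + alpha k ^+ 2 * sigma ^+ 2.
  rewrite -average_residual (_ : alpha k ^+ 2 * sigma ^+ 2 =
    (\sum_s prob s) * (alpha k ^+ 2 * sigma ^+ 2)); last first.
    by rewrite sum_prob mul1r.
  rewrite mulr_suml mulr_sumr -sumrB -big_split; apply: eq_bigr => s _ /=.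
  (* A sequence of nonzero probability is realized by some outcome and inherits its injectivity; the
     others carry no mass. *)
  have [->|/index_prob_gt0[t ts]] := eqVneq (prob s) 0.
    by rewrite !mul0r mulr0 subr0 addr0.
  rewrite /err (weighted_error_step (sigma := sigma) alpha A_neq0)//.
    by rewrite -/(err s k); ring.
  move=> l l'; rewrite -!ts; case: i_sampled => _ i_inj _; exact: i_inj.
rewrite lerD2r [(1 - _) * _]mulrBl mul1r lerD2l lerN2 (mulrC eta) -mulrA.
apply: ler_wpM2l; first by nra.
rewrite mulr_sumr; apply: ler_sum => s _; rewrite mulrCA.
have [->|ps] := eqVneq (prob s) 0; first by rewrite !mul0r.
have [t ts] := index_prob_gt0 ps.
rewrite ler_wpM2l ?index_prob_ge0//.
have fi : first_indices (fun l => i l t) k = first_indices s k.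
  by apply: eq_imset => l.
move: bound => /(_ t); rewrite fi; set S := first_indices s k => bound.
set W := \sum_(l in ~: S) _ in bound.
have W0 : 0 < W by exact: remaining_weight_gt0.
(* The sampling weight |a_j|^2 cancels the denominator of the residual, leaving a sum over the
   remaining rows divided by [W]. *)
have -> : \sum_j next s k j * weighted_residual A alpha weight (x0 - x) s k j =
    \sum_o weight o * ((\sum_(l in ~: S) inner (row_vec A l)
       (error_coef A alpha (x0 - x) s k o) ^+ 2) / W).
  under [RHS]eq_bigr do rewrite mulr_suml mulr_sumr.
  rewrite exchange_big [RHS]big_mkcond /=; apply: eq_bigr => j _.
  rewrite /next -/S inE; case: ifP => jS; first by rewrite mul0r.
  have -> : \sum_(l in ~: S) l2norm (row_vec A l) ^+ 2 = W.
    by apply: eq_bigr => l _; rewrite sqr_l2norm.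
  rewrite /weighted_residual /= mulrC mulr_suml mulr_suml.
  apply: eq_bigr => o _.
  rewrite sqr_l2norm; field.
  by rewrite !gt_eqF ?inner_gt0.
rewrite /err /weighted_error mulr_sumr; apply: ler_sum => o _.
rewrite mulrCA ler_wpM2l// ler_pdivlMr// mulrAC; exact: bound.
Qed.

End mean_square_error.

Theorem theorem1p1 (R : realType) (m n : nat) (A : 'M[R]_(m, n))
    (x x0 : 'cV[R]_n) (b : 'cV[R]_m) (sigma eta : R) (N : nat)
    (d : measure_display) (T : measurableType d) (P : probability T R)
    (eps : 'I_m -> {RV P >-> R}) (i : 'I_m -> T -> 'I_m) :
  (forall j, row_vec A j != 0) ->
  A *m x = b ->
  0 < sigma ->
  mutually_independent eps ->
  (forall j, ('E_P[eps j] = 0)%E) ->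
  (forall j, ('V_P[eps j] = (sigma ^+ 2 * l2norm (row_vec A j) ^+ 2)%R%:E)%E) ->
  x0 != x ->
  sampled_without_replacement P (fun j => l2norm (row_vec A j) ^+ 2) i ->
  independent_of_noise i eps ->
  0 < eta ->
  (N <= m)%N ->
  (forall (k : nat) (t : T), (k < N)%N ->
     let A_k := delete_rows (first_indices (fun l => i l t) k) A in
     row_full A_k /\ eta <= kappa A_k ^- 2) ->
  let btilde (t : T) : 'cV[R]_m := b + \col_j eps j t in
  let beta := beta_seq eta (l2norm (x - x0) ^+ 2 / sigma ^+ 2) in
  let alpha := alpha_seq eta (l2norm (x - x0) ^+ 2 / sigma ^+ 2) in
  let X (k : nat) (t : T) :=
    kaczmarz A (btilde t) alpha x0 (fun l => i l t) k in
  let r := sigma ^+ 2 / (eta * l2norm (x - x0) ^+ 2) in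
  let c := r * expR r in
  let f (k : nat) := sigma ^+ 2 / (eta * lambertW (c * expR (eta * k%:R))) in
  forall k : nat, (k <= N)%N ->
    ('E_P[fun t => (l2norm (X k t - x) ^+ 2)%R] <= (sigma ^+ 2 * beta k)%:E)%E
    /\ sigma ^+ 2 * beta k <= f k.

Proof.
move=> A_neq0 Axb sigma0 eps_indep eps_mean eps_var x0x i_sampled i_eps eta0 Nm
  bound btilde beta alpha X r c f.
have e0 : x0 - x != 0 by rewrite subr_eq0.
have normE : l2norm (x - x0) ^+ 2 = inner (x0 - x) (x0 - x).
  by rewrite sqr_l2norm -opprB -scaleN1r innerZl innerZr; ring.
have q0 := inner_gt0 e0.
have beta00 : 0 < l2norm (x - x0) ^+ 2 / sigma ^+ 2.
  by rewrite normE divr_gt0// exprn_gt0.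
have bound_inner (k : nat) t e : (k < N)%N ->
    eta * (\sum_(l in ~: first_indices (fun l => i l t) k)
        inner (row_vec A l) (row_vec A l)) * inner e e <=
     \sum_(l in ~: first_indices (fun l => i l t) k) inner (row_vec A l) e ^+ 2.
  move=> kN; have [full etak] := bound k t kN.
  exact: delete_rows_lower_bound.
(* At k = 0 no index has been chosen, so any outcome serves. Cauchy-Schwarz on each row bounds |A
   e|^2 by |A|_F^2 |e|^2, which forces eta <= 1. *)
have eta1 : (0 < N)%N -> eta <= 1.
  move=> N0; have := bound_inner 0%N point (x0 - x) N0.
  have := remaining_weight_gt0 (fun l => i l point)
    (Ordinal (leq_trans N0 Nm)) A_neq0.
  rewrite /=; set W := \sum_(l in _) _ => W0 le.
  rewrite -(ler_pM2r (mulr_gt0 W0 q0)) mul1r mulrA; apply: le_trans le _.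
  by rewrite mulr_suml; apply: ler_sum => l _; exact: cauchy_schwarz.
move=> k kN; have eta1k : (0 < k)%N -> eta <= 1.
  by move=> k0; apply: eta1; exact: leq_trans kN.
split; last first.
  have := beta_seq_le_lambertW eta0 beta00 eta1k.
  rewrite -(ler_pM2l (exprn_gt0 2 sigma0)) => /le_trans; apply.
  rewrite /f /c (_ : r = (eta * (l2norm (x - x0) ^+ 2 / sigma ^+ 2))^-1)//.
  by rewrite /r normE; field; rewrite !gt_eqF.
rewrite (expectation_kaczmarz alpha x0 Axb eps_indep eps_mean eps_var
  i_sampled i_eps).
rewrite lee_fin; elim: k kN {eta1k} => [_|k IH kN].
  rewrite /mean_square_error mulrC divfK ?sqrf_eq0 ?gt_eqF// normE.
  rewrite -[leRHS]mul1r -(sum_prob i_sampled) mulr_suml.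
  apply: ler_sum => s _; apply: ler_wpM2l; first exact: index_prob_ge0.
  (* Before the first step only the constant coordinate has a nonzero coefficient. *)
  rewrite /weighted_error (bigD1 None)//= mul1r big1 ?addr0// => -[j|]//= _.
  by rewrite inner0r mulr0.
have etaN1 : eta <= 1 by apply: eta1; exact: leq_ltn_trans kN.
have b0 : 0 < beta k by apply: beta_seq_gt0.
have eb : 0 < eta * beta k by rewrite mulr_gt0.
have /andP[a0 a1] := relaxation_itv eta0 b0; rewrite -/(alpha k) in a0 a1.
have aE : alpha k * (eta * beta k + 1) = eta * beta k.
  by rewrite divfK// gt_eqF// addr_gt0.
have := @mean_square_error_step _ _ _ _ _ _ _ alpha x x0 sigma eta i A_neq0
  i_sampled (Ordinal (leq_trans kN Nm)).
rewrite ltW// ltW// => /(_ isT (fun t e => bound_inner k t e kN)) /le_trans.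
apply.
(* The induction hypothesis can be inserted because the factor is nonnegative: 2 alpha - alpha^2 = 1
   - (1 - alpha)^2 <= 1 and eta <= 1. *)
apply: le_trans (_ : (1 - eta * (2 * alpha k - alpha k ^+ 2)) *
  (sigma ^+ 2 * beta k) + alpha k ^+ 2 * sigma ^+ 2 <= _).
  rewrite lerD2r ler_wpM2l ?IH 1?ltnW// subr_ge0.
  have := sqr_ge0 (1 - alpha k).
  by move=> ?; apply: mulr_ile1 => //; [exact: ltW | nra | lra].
have -> : beta k.+1 = beta k * (1 - eta * alpha k) by [].
rewrite le_eqVlt; apply/orP; left; apply/eqP.
(* The identity alpha (eta beta + 1) = eta beta collapses the quadratic in alpha to beta (1 - eta
   alpha). *)
transitivity (sigma ^+ 2 * (beta k - 2 * eta * beta k * alpha k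
  + alpha k * (alpha k * (eta * beta k + 1)))); first by ring.
by rewrite aE; ring.
Qed.
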